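(* Let $0<a<b<\infty$, let $\pi_1$ be a probability density on $\mathbb{R}_+$ with compact support in $\mathbb{R}_+$, and let $\pi_t(x)=t^{-1}\pi_1(t^{-1}x)$ for $t\in[a,b]$. Then the Legendre polynomial estimator $\hat f_{m,n}$ defined in the context achieves the mean integrated squared error rate $(\log n)^{-2\alpha}$ uniformly on $\mathcal{C}(\alpha,C)\cap\mathbb{H}_1$ for any $\alpha>0$ and $C>0$. That is, there is a constant $A>0$ such that, with $m_n=\lfloor A\log n\rfloor$, for all $\alpha>0$ and $C>0$, $$\sup_{f\in\mathcal{C}(\alpha,C)\cap\mathbb{H}_1}\mathbb{E}_f\left\|\hat f_{m_n,n}-f\right\|_{\mathbb{H}}^2=O\left((\log n)^{-2\alpha}\right)\quad\text{as }n\to\infty.$$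
   Context: Densities are with respect to Lebesgue measure. $\mathbb{H}=L^2([a,b])$; $\mathbb{H}_1=\{f\in\mathbb{H}:f\ge0,\ \int_a^bf=1\}$. For $f\in\mathbb{H}_1$, $\pi_f(x)=\int_a^bf(t)\pi_t(x)\,dt$, and $\mathbb{E}_f$ is expectation when $X_1,\dots,X_n$ are i.i.d. with density $\pi_f$. $V_m$ is the space of polynomials of degree at most $m-1$ on $[a,b]$ (the span of $\varphi_k(t)=t^{k-1}$, $1\le k\le m$), $P_{V_m}$ is the orthogonal projection of $\mathbb{H}$ onto $V_m$, and $$\mathcal{C}(\alpha,C)=\{f\in\mathbb{H}:\|f\|_{\mathbb{H}}\le C\text{ and }\|P_{V_m}f-f\|_{\mathbb{H}}\le C\,m^{-\alpha}\text{ for all }m\ge1\}.$$ Estimator: let $g_k(x)=\left(\int x^{k-1}\pi_1(x)\,dx\right)^{-1}x^{k-1}$ and let $p_k(t)=\sum_{j=1}^kQ_{k,j}t^{j-1}$, $k\ge1$, be the normalized Legendre polynomials on $[a,b]$, i.e. the orthonormal sequence in $\mathbb{H}$ with $p_k$ of degree $k-1$ and positive leading coefficient. Then $$\hat f_{m,n}(t)=\sum_{k=1}^m\left(\frac1n\sum_{i=1}^n\sum_{j=1}^kQ_{k,j}g_j(X_i)\right)p_k(t).$$ *)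

(* Defs.v *)
From HB Require Import structures.
From mathcomp Require Import all_boot all_order all_algebra.
From mathcomp Require Import all_classical all_reals all_analysis.

Set Implicit Arguments.
Unset Strict Implicit.
Unset Printing Implicit Defensive.

Import Order.TTheory GRing.Theory Num.Theory.
Import numFieldNormedType.Exports.

Local Open Scope classical_set_scope.
Local Open Scope ring_scope.

Section L2.
Variable R : realType.
Variables a b : R.
Notation mu := (@lebesgue_measure R).

(* An element of L^2([a, b]) is represented by a function R -> R, of which only
   the restriction to [a, b], up to null sets, is relevant. *)
Definition L2 : set (R -> R) := [set f | f \_ `[a, b] \in Lfun mu 2%:E].

Definition L2norm (f : R -> R) : \bar R :=
  ('N[mu]_2%:E [EFin \o f \_ `[a, b]])%E.

Definition L2dot (f g : R -> R) : R :=
  Rintegral mu `[a, b] (fun t => f t * g t).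

Definition H1 : set (R -> R) :=
  [set f | [/\ L2 f,
               {ae mu, forall t, t \in `[a, b] -> 0 <= f t} &
               (\int[mu]_(t in `[a, b]) (f t)%:E = 1)%E]].

(* V_m is [set q : {poly R} | (size q <= m)%N], as size q = deg q + 1. *)
Definition is_proj (m : nat) (f : R -> R) (p : {poly R}) : Prop :=
  (size p <= m)%N /\
  forall q : {poly R}, (size q <= m)%N ->
    L2dot (fun t => p.[t] - f t) (fun t => q.[t]) = 0.

Definition approx_class (alpha C : R) : set (R -> R) :=
  [set f | [/\ L2 f,
               (L2norm f <= C%:E)%E &
               forall m : nat, (1 <= m)%N ->
                 exists2 p : {poly R}, is_proj m f p &
                   (L2norm (fun t => (p.[t] - f t)%R)
                      <= (C * m%:R `^ (- alpha))%:E)%E]].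

(* Indices start at 0: p k has degree k. *)
Definition legendre (p : nat -> {poly R}) : Prop :=
  [/\ forall k, size (p k) = k.+1,
      forall k, 0 < lead_coef (p k) &
      forall k l, L2dot (fun t => (p k).[t]) (fun t => (p l).[t])
                  = (k == l)%:R].

End L2.

Section Mixture.
Variable R : realType.
Variables a b : R.
Variable pi1 : R -> R.
Notation mu := (@lebesgue_measure R).

Definition density : Prop :=
  [/\ measurable_fun [set: R] pi1,
      forall x, 0 <= pi1 x &
      (\int[mu]_x (pi1 x)%:E = 1)%E].

Definition compact_support_nonneg : Prop :=
  compact (closure [set x | pi1 x != 0]) /\
  closure [set x | pi1 x != 0] `<=` [set x | 0 <= x].

Definition scaled (t x : R) : R := t^-1 * pi1 (t^-1 * x).

(* Extended-real valued: the integral may be infinite for x in a null set. *)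
Definition mixture (f : R -> R) (x : R) : \bar R :=
  (\int[mu]_(t in `[a, b]) (f t * scaled t x)%:E)%E.

Definition g (k : nat) (x : R) : R :=
  (Rintegral mu [set: R] (fun y => y ^+ k * pi1 y))^-1 * x ^+ k.

Definition estimator (p : nat -> {poly R}) (m n : nat) (x : 'I_n -> R)
    (t : R) : R :=
  \sum_(k < m)
    (n%:R^-1 * \sum_(i < n) \sum_(j < k.+1) (p k)`_j * g j (x i)) * (p k).[t].

End Mixture.

Section Sample.
Variable R : realType.
Context {d : measure_display} {T : measurableType d} (P : probability T R).
Variable n : nat.

Definition mutually_independent (X : 'I_n -> {RV P >-> R}) : Prop :=
  forall (J : {set 'I_n}) (B : 'I_n -> set R),
    (forall i, measurable (B i)) ->
    (P (\bigcap_(i in [set` J]) X i @^-1` B i)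
     = \prod_(i in J) P (X i @^-1` B i))%E.

Definition has_density (X : {RV P >-> R}) (h : R -> \bar R) : Prop :=
  forall B : set R, measurable B ->
    distribution P X B = (\int[@lebesgue_measure R]_(x in B) h x)%E.

Definition iid_sample (X : 'I_n -> {RV P >-> R}) (h : R -> \bar R) : Prop :=
  mutually_independent X /\ forall i, has_density (X i) h.

End Sample.

(* is_mise holds of e when e = E_f || fhat_{m,n} - f ||^2; the value depends only
   on the law of the sample, whatever probability space carries it. *)
Definition is_mise (R : realType) (a b : R) (pi1 : R -> R)
    (p : nat -> {poly R}) (m n : nat) (f : R -> R) (e : \bar R) : Prop :=
  exists (d : measure_display) (T : measurableType d) (P : probability T R)
         (X : 'I_n -> {RV P >-> R}),
    iid_sample X (mixture a b pi1 f) /\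
    e = (\int[P]_w
      (L2norm a b
         (fun t => estimator pi1 p m (fun i => X i w) t - f t)%R ^+ 2))%E.

(* Main.v *)
Require Import Defs.
From HB Require Import structures.
From mathcomp Require Import all_boot all_order all_algebra.
From mathcomp Require Import all_classical all_reals all_analysis.
From mathcomp Require Import measurable_realfun ring lra.

Set Implicit Arguments.
Unset Strict Implicit.
Unset Printing Implicit Defensive.

Import Order.TTheory GRing.Theory Num.Theory.
Import numFieldNormedType.Exports.

Local Open Scope classical_set_scope.
Local Open Scope ring_scope.

(* If [X] has density [pi_f], Tonelli's theorem and the scaling [x = t y] give
   [E X^j = (int y^j pi1(y) dy) (int f(t) t^j dt)], so each estimated coefficient
   is unbiased for the Legendre coefficient of [f]. By Pythagoras the error is
   the sum of the variances of the first [m] estimated coefficients plus the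
   squared distance from [f] to [V_m], which the class bounds by
   [C^2 m^(-2 alpha)].
   A variance is at most [1/n] times the squared supremum of a polynomial on the
   bounded range of [X]; it grows at most geometrically in the degree, because
   [int y^j pi1(y) dy >= (int y pi1(y) dy)^j] by Jensen and because Lagrange
   interpolation bounds the coefficients of a normalized polynomial of degree
   [k] on [a, b] by a geometric sequence in [k]. Hence the variance part is
   [O(B^m / n)], which is [O(n^(-1/2))] for [m <= A log n] with [A] small. *)

(** * Sums of absolute coefficients and Lagrange interpolation *)

Section CoefficientNorm.
Variable R : realFieldType.
Implicit Types (p q : {poly R}) (n : nat).

(** The window [n] is independent of the size of [p]: one [n] then serves for all partial products
    in an induction. *)
Definition coef_norm n p : R := \sum_(i < n) `|p`_i|.

Lemma coef_normD n p q : coef_norm n (p + q) <= coef_norm n p + coef_norm n q.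
Proof.
by rewrite -big_split; apply: ler_sum => i _; rewrite coefD ler_normD.
Qed.

Lemma coef_normZ n c p : coef_norm n (c *: p) = `|c| * coef_norm n p.
Proof. by rewrite mulr_sumr; apply: eq_bigr => i _; rewrite coefZ normrM. Qed.

Lemma coef_norm_sum n (I : Type) (r : seq I) (P : pred I) (F : I -> {poly R}) :
  coef_norm n (\sum_(i <- r | P i) F i) <= \sum_(i <- r | P i) coef_norm n (F i).
Proof.
apply: (big_ind2 (fun p x => coef_norm n p <= x)) => //.
  by rewrite /coef_norm big1// => i _; rewrite coef0 normr0.
by move=> p x q y px qy; rewrite (le_trans (coef_normD _ _ _))// lerD.
Qed.

Lemma coef_norm_ge0 n p : 0 <= coef_norm n p.
Proof. exact: sumr_ge0. Qed.

Lemma coef_norm1 n : coef_norm n 1 <= 1.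
Proof.
case: n => [|n]; first by rewrite /coef_norm big_ord0.
by rewrite /coef_norm big_ord_recl/= coef1 normr1 big1 ?addr0// => i _;
  rewrite coef1 normr0.
Qed.

(** Multiplication by ['X] shifts the coefficients and pushes the last one out of the window, so it
    does not increase the sum. *)
Lemma coef_norm_mulXsubC n p c :
  coef_norm n (('X - c%:P) * p) <= (1 + `|c|) * coef_norm n p.
Proof.
rewrite mulrBl mulrDl mul1r mul_polyC -scaleNr (le_trans (coef_normD _ _ _))//.
rewrite lerD ?coef_normZ ?normrN//.
case: n => [|n]; first by rewrite /coef_norm !big_ord0.
rewrite /coef_norm big_ord_recl coefXM/= normr0 add0r [leRHS]big_ord_recr/=.
rewrite ler_wpDr//; apply: ler_sum => i _.
by rewrite coefXM.
Qed.

Lemma coef_norm_prod_XsubC n (I : Type) (r : seq I) (P : pred I) (c : I -> R) :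
  coef_norm n (\prod_(i <- r | P i) ('X - (c i)%:P)) <=
  \prod_(i <- r | P i) (1 + `|c i|).
Proof.
elim/big_rec2: _ => [|i x p _ h]; first exact: coef_norm1.
rewrite (le_trans (coef_norm_mulXsubC _ _ _))// ler_wpM2l//.
Qed.

(** The difference of the two sides has degree at most [k] and vanishes at the [k.+1] distinct
    nodes. *)
Lemma lagrange_interpolation k (x : 'I_k.+1 -> R) p :
  injective x -> (size p <= k.+1)%N ->
  p = \sum_i (p.[x i] / \prod_(j | j != i) (x i - x j)) *:
        \prod_(j | j != i) ('X - (x j)%:P).
Proof.
move=> xinj sp; apply/eqP; rewrite -subr_eq0.
set q := \sum_i _; apply/eqP.
have sq : (size q <= k.+1)%N.
  apply: (leq_trans (size_sum _ _ _)); apply/bigmax_leqP => i _.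
  apply: leq_trans (size_scale_leq _ _) _.
  rewrite -big_enum size_prod_XsubC -cardE.
  by have := cardC1 i; rewrite card_ord ltnS => /= ->.
apply: (@roots_geq_poly_eq0 _ _ [seq x i | i <- enum 'I_k.+1]).
- apply/allP => _ /mapP[i _ ->]; rewrite /root hornerD hornerN subr_eq0.
  rewrite horner_sum (bigD1 i)//= hornerZ horner_prod.
  rewrite [X in _ * X](eq_bigr (fun j => x i - x j)) => [|j _]; last first.
    by rewrite hornerXsubC.
  rewrite mulfVK; last first.
    apply/prodf_neq0 => j ji; rewrite subr_eq0 eq_sym.
    by apply: contraNneq ji => /xinj ->.
  rewrite big1 ?addr0// => l li; rewrite hornerZ horner_prod.
  rewrite [X in _ * X](bigD1 i) 1?eq_sym//= hornerXsubC.
  by rewrite subrr !mul0r mulr0.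
- by rewrite map_inj_uniq ?enum_uniq.
- rewrite size_map size_enum_ord.
  by rewrite (leq_trans (size_polyD _ _))// geq_max sp size_polyN.
Qed.

(** Each Lagrange basis polynomial is a product of [k] factors ['X - x j], each costing at most
    [1 + b], with a weight of size at most [M / e]. *)
Lemma coef_norm_interpolation n k (x : 'I_k.+1 -> R) p (M b e : R) :
  injective x -> (size p <= k.+1)%N ->
  (forall i, `|p.[x i]| <= M) -> (forall i, `|x i| <= b) -> 0 < e ->
  (forall i, e <= `|\prod_(j | j != i) (x i - x j)|) ->
  coef_norm n p <= k.+1%:R * (M / e * (1 + b) ^+ k).
Proof.
move=> xinj sp pM xb e0 xe.
rewrite {1}(lagrange_interpolation xinj sp) (le_trans (coef_norm_sum _ _ _ _))//.
rewrite (_ : _ * _ = \sum_(i < k.+1) (M / e * (1 + b) ^+ k)); last first.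
  by rewrite sumr_const card_ord mulr_natl.
apply: ler_sum => i _; rewrite coef_normZ ler_pM//; first exact: coef_norm_ge0.
  rewrite normrM ler_pM// normfV lef_pV2 ?posrE ?xe//.
  exact: lt_le_trans (xe i).
rewrite (le_trans (coef_norm_prod_XsubC _ _ _ _))//.
apply: (@le_trans _ _ (\prod_(j < k.+1 | j != i) (1 + b))).
  by apply: ler_prod => j _; rewrite addr_ge0//= lerD2l.
by rewrite prodr_const; have := cardC1 i; rewrite card_ord => /= ->.
Qed.

End CoefficientNorm.

(** * Products of distances between equally spaced nodes *)

Section Nodes.
Variable R : realFieldType.

Lemma expn_leq_fact k : (k.+1 ^ k <= 4 ^ k * k`!)%N.
Proof.
(* [(k + 1)^k <= (k + 1) ... (2 k) = 'C(2 k, k) k! <= 4^k k!] *)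
have h : (k.+1 ^ k <= (k + k) ^_ k)%N.
  rewrite ffact_prod -[X in (_ ^ X)%N]card_ord -prod_nat_const.
  by apply: leq_prod => i _; rewrite -addnBA ?(ltnW (ltn_ord i))//
     -addn1 leq_add2l subn_gt0.
rewrite (leq_trans h)// -bin_ffact leq_mul2r; apply/orP; right.
have := expnDn 1 1 (k + k); rewrite addn1 => eq2.
rewrite (_ : 4 = 2 ^ 2)%N// -expnM mul2n -addnn eq2.
have kk : (k < (k + k).+1)%N by rewrite ltnS leq_addr.
by rewrite (bigD1 (Ordinal kk))//= !exp1n !muln1 leq_addr.
Qed.

(** The indices below [i] contribute the distances [1, ..., i], those above it [1, ..., k - i]. *)
Lemma prod_dist_ord k (i : 'I_k.+1) :
  \prod_(j < k.+1 | j != i) `|i%:R - j%:R| = (i`! * (k - i)`!)%:R :> R.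
Proof.
transitivity (\prod_(0 <= j < k.+1 | j != i) `|i%:R - j%:R| : R).
  by rewrite big_mkord; apply: eq_bigl => j.
rewrite (@big_cat_nat _ _ _ i)/=; [|by []|exact: ltnW].
rewrite [X in _ * X]big_ltn_cond ?ltn_ord//.
rewrite eqxx /= natrM; congr (_ * _).
- rewrite fact_prod natr_prod big_add1 /= big_nat_cond.
  rewrite (eq_bigl (fun j => (0 <= j < i)%N)); last first.
    by move=> j /=; case: ltnP; rewrite ?andbF//= => h; rewrite ltn_eqF.
  rewrite -big_nat big_nat_rev/= add0n; apply: eq_big_nat => j /= ji.
  by rewrite -natrB ?leq_subr// subKn// normr_nat.
- rewrite fact_prod natr_prod [RHS]big_add1 /=.
  rewrite -[X in \prod_(X <= _ < _ | _) _]add0n big_addn.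
  rewrite subSS.
  rewrite big_nat_cond (eq_bigl (fun j => (0 <= j < k - i)%N)); last first.
    move=> j /=; case: ltnP; rewrite ?andbF//= => h.
    by rewrite gtn_eqF// addnS ltnS leq_addl.
  rewrite -big_nat; apply: eq_big_nat => j _.
  by rewrite distrC -natrB addnS ?leqW ?leq_addl// subSn ?leq_addl// addnK normr_nat.
Qed.

(** [i! (k - i)!] is [k!] divided by a binomial coefficient, which is at most [2 ^ k], and [k!] is
    at least [((k + 1) / 4) ^ k]. *)
Lemma prod_dist_ord_ge k (i : 'I_k.+1) :
  (k.+1%:R / 8) ^+ k <= \prod_(j < k.+1 | j != i) `|i%:R - j%:R| :> R.
Proof.
rewrite prod_dist_ord expr_div_n ler_pdivrMr ?exprn_gt0// -!natrX -natrM ler_nat.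
rewrite (leq_trans (expn_leq_fact k))// -[8%N]/(2 * 4)%N expnMn mulnCA mulnC.
rewrite mulnA leq_mul2r; apply/orP; right.
have ik : (i <= k)%N by rewrite -ltnS.
have <- := bin_fact ik.
rewrite leq_mul2r; apply/orP; right.
have := expnDn 1 1 k; rewrite addn1 => ->.
by rewrite (bigD1 i)//= !exp1n !muln1 leq_addr.
Qed.

End Nodes.

(** * Geometric growth of the coefficients of the Legendre polynomials *)

Section LegendreCoefficients.
Variable R : realType.
Notation mu := (@lebesgue_measure R).

Lemma integrable_poly (a b : R) (p : {poly R}) :
  mu.-integrable `[a, b] (EFin \o (fun t => p.[t])).
Proof.
apply: continuous_compact_integrable; first exact: segment_compact.
by apply: continuous_subspaceT => x; exact: continuous_horner.
Qed.

(** Otherwise [p ^ 2] is at least [2 / h] on an interval of length [h], and its integral is at least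
    2. *)
Lemma small_value_itv (p : {poly R}) (a b u h : R) :
  a <= u -> 0 < h -> u + h <= b ->
  \int[mu]_(t in `[a, b]) p.[t] ^+ 2 <= 1 ->
  exists2 x, u <= x <= u + h & `|p.[x]| <= 1 + 2 / h.
Proof.
move=> au h0 hb p1; apply: contrapT => /forall2NP hx.
have {}hx x : u <= x <= u + h -> 2 / h <= p.[x] ^+ 2.
  move=> xuh; case: (hx x) => // /negP; rewrite -ltNge => lt1.
  have h2 : 0 <= 2 / h by rewrite divr_ge0// ltW.
  rewrite -[leRHS]real_normK ?num_real//.
  rewrite (@le_trans _ _ ((1 + 2 / h) ^+ 2))//; last first.
    by rewrite lerXn2r ?nnegrE ?addr_ge0// ltW.
  by rewrite sqrrD expr1n mul1r; have := sqr_ge0 (2 / h); lra.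
have : 2 / h * h <= 1; last by rewrite divfK ?gt_eqF//; lra.
apply: le_trans p1.
have pE : (fun t => p.[t] ^+ 2) = (fun t => (p ^+ 2).[t]).
  by apply/funext => t; rewrite horner_exp.
have sub : `[u, u + h] `<=` `[a, b].
  by apply: subset_itv; rewrite bnd_simp.
have -> : 2 / h * h = \int[mu]_(t in `[u, u + h]) (2 / h).
  rewrite Rintegral_cst//= lebesgue_measure_itv/= lte_fin ltrDl h0/=.
  by rewrite addrAC subrr add0r.
apply: (@le_trans _ _ (\int[mu]_(t in `[u, u + h]) p.[t] ^+ 2)).
  apply: le_Rintegral => //.
  - rewrite (_ : (fun=> _) = fun t => (2 / h)%:P.[t]); first exact: integrable_poly.
    by apply/funext => t; rewrite hornerC.
  - by rewrite pE; exact: integrable_poly.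
rewrite pE; apply: fine_le.
- by apply: integrable_fin_num => //; exact: integrable_poly.
- by apply: integrable_fin_num => //; exact: integrable_poly.
apply: ge0_subset_integral => //.
- exact: measurable_int (integrable_poly a b _).
- by move=> t _; rewrite lee_fin horner_exp sqr_ge0.
Qed.

Lemma coef_norm_legendre (a b : R) (p : nat -> {poly R}) :
  0 < a -> a < b -> legendre a b p ->
  exists D B : R, [/\ 0 < D, 1 <= B & forall k, coef_norm k.+1 (p k) <= D * B ^+ k].
Proof.
move=> a0 ab [sp _ orth].
have ba0 : 0 < b - a by rewrite subr_gt0.
(* Interpolation gives the base [16 * (1 + b) / (b - a)] up to a factor quadratic in [k.+1]. As
   [k.+1 ^ 2 <= 4 ^ k], multiplying the base by 4 absorbs that factor. *)
exists (1 + 4 / (b - a)), (64 * (1 + b) / (b - a)); split.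
- by rewrite addr_gt0// divr_gt0.
- by rewrite ler_pdivlMr// mul1r; lra.
(* Interpolate [p k] at one node in each of [k + 1] intervals of length [h] with
   gaps [h]; since [p k] has norm 1, each interval has a node where it is
   [O(1 / h)]. *)
move=> k; set h := (b - a) / (2 * k.+1%:R).
have h0 : 0 < h by rewrite divr_gt0// mulr_gt0.
have hk : h * (2 * k.+1%:R) = b - a by rewrite divfK// gt_eqF// mulr_gt0.
have ex (i : 'I_k.+1) : exists x, a + 2 * i%:R * h <= x <= a + 2 * i%:R * h + h /\
    `|(p k).[x]| <= 1 + 2 / h.
  have ih0 : 0 <= 2 * i%:R * h by rewrite mulr_ge0// ltW.
  have ihk : (i%:R + 1) * h <= k.+1%:R * h.
    by rewrite ler_pM2r// natr1 ler_nat.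
  have [|||| x xu px] := @small_value_itv (p k) a b (a + 2 * i%:R * h) h.
  - by rewrite lerDl.
  - by [].
  - by lra.
  - rewrite (_ : \int[mu]_(t in _) _ =
        L2dot a b (fun t => (p k).[t]) (fun t => (p k).[t])); last first.
      by apply: eq_Rintegral => t _; rewrite expr2.
    by rewrite orth eqxx.
  - by exists x.
have [x xP] := choice ex.
(* For [i < j] the nodes differ by at least [(2 * (j - i) - 1) * h], which is at least
   [(j - i) * h]. *)
have dist (i j : 'I_k.+1) : `|i%:R - j%:R| * h <= `|x i - x j|.
  wlog ij : i j / (i < j)%N.
    move=> wl; have [ij|ji|/val_inj ->] := ltngtP i j; first exact: wl.
    - by rewrite distrC (distrC (x i)); exact: wl.
    - by rewrite !subrr normr0 mul0r.
  rewrite distrC (distrC (x i)) ger0_norm ?subr_ge0 ?ler_nat 1?ltnW//.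
  have /andP[_ xi] := (xP i).1; have /andP[xj _] := (xP j).1.
  apply: le_trans (ler_norm _).
  have : (i%:R + 1) * h <= j%:R * h by rewrite ler_pM2r// natr1 ler_nat.
  by lra.
have xinj : injective x.
  move=> i j xij; have := dist i j; rewrite xij subrr normr0 pmulr_lle0//.
  rewrite normr_le0 subr_eq0 eqr_nat => /eqP; exact: val_inj.
(* [(b - a) / 16] is [h * (k + 1) / 8]: the bound for integer nodes, rescaled by [h]. *)
have e0 : 0 < ((b - a) / 16) ^+ k :> R by rewrite exprn_gt0// divr_gt0.
have xb i : `|x i| <= b.
  have /andP[x1 x2] := (xP i).1.
  have ih0 : 0 <= 2 * i%:R * h by rewrite mulr_ge0// ltW.
  have ihk : (i%:R + 1) * h <= k.+1%:R * h.
    by rewrite ler_pM2r// natr1 ler_nat.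
  by rewrite ger0_norm; lra.
have xe i : ((b - a) / 16) ^+ k <= `|\prod_(j | j != i) (x i - x j)|.
  rewrite normr_prod.
  apply: (@le_trans _ _ (\prod_(j < k.+1 | j != i) (`|i%:R - j%:R| * h))); last first.
    by apply: ler_prod => j _; rewrite dist mulr_ge0// ltW.
  rewrite big_split/= prodr_const; have := cardC1 i; rewrite card_ord => /= ->.
  apply: le_trans (ler_wpM2r _ (prod_dist_ord_ge _ _)); last by rewrite exprn_ge0// ltW.
  rewrite -exprMn lerXn2r ?nnegrE// ?divr_ge0// ?(ltW ba0)//.
    by rewrite mulr_ge0// ?divr_ge0// ltW.
  by lra.
have := coef_norm_interpolation k.+1 xinj _ (fun i => (xP i).2) xb e0 xe.
rewrite sp => /(_ (leqnn _))/le_trans; apply.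
have -> : (64 * (1 + b) / (b - a)) ^+ k =
    4 ^+ k * ((1 + b) ^+ k / ((b - a) / 16) ^+ k).
  rewrite -expr_div_n -exprMn; congr (_ ^+ _); field.
  by rewrite gt_eqF.
rewrite mulrAC -[X in _ * X]mulrA !mulrA -[leRHS]mulrA -[leLHS]mulrA ler_wpM2r//.
  by rewrite divr_ge0 ?(ltW e0)// exprn_ge0//; lra.
have -> : 2 / h = k.+1%:R * (4 / (b - a)).
  by rewrite /h; field; rewrite gt_eqF//= gt_eqF.
have kk : k.+1%:R ^+ 2 <= 4 ^+ k :> R.
  rewrite -!natrX ler_nat (_ : 4 = 2 ^ 2)%N// -expnM mulnC expnM leq_exp2r//.
  exact: ltn_expl.
have k1 : 1 <= k.+1%:R :> R by rewrite ler1n.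
have d0 : 0 <= 4 / (b - a) by rewrite divr_ge0// ltW.
rewrite [leLHS](_ : _ = k.+1%:R + k.+1%:R ^+ 2 * (4 / (b - a))); last by ring.
rewrite [leRHS]mulrDl mul1r lerD//; last by rewrite mulrC ler_wpM2l.
by rewrite (le_trans _ kk)// expr2 ler_peMl.
Qed.

End LegendreCoefficients.

(** * Inner product and norm on square integrable functions *)

Section SquareIntegrable.
Variable R : realType.
Variables a b : R.
Notation mu := (@lebesgue_measure R).
Implicit Types (f g h : R -> R) (p q : {poly R}).

Lemma L2_mul_integrable f g : L2 a b f -> L2 a b g ->
  mu.-integrable `[a, b] (EFin \o (fun t => f t * g t)).
Proof.
move=> f2 g2; have /Lfun1_integrable := Lfun2_mul_Lfun1 f2 g2.
rewrite (_ : EFin \o _ = (EFin \o (fun t => f t * g t)) \_ `[a, b]).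
  by move=> fg; apply/integrable_mkcond.
apply/funext => t /=; rewrite !patchE; case: ifPn => //= _.
by rewrite mul0r.
Qed.

Lemma L2D f g : L2 a b f -> L2 a b g -> L2 a b (fun t => f t + g t).
Proof.
move=> f2 g2; rewrite /L2/= (_ : _ \_ _ = (f \_ `[a, b]) + (g \_ `[a, b])).
  by apply: (Lfun_addr_closed mu (lee1n 2)).2.
by apply/funext => t; rewrite /= fctE !patchE; case: ifPn => //= _; rewrite addr0.
Qed.

Lemma L2N f : L2 a b f -> L2 a b (fun t => - f t).
Proof.
move=> f2; rewrite /L2/= (_ : _ \_ _ = - (f \_ `[a, b])).
  exact: Lfun_oppr_closed.
by apply/funext => t; rewrite /= fctE !patchE; case: ifPn => //= _; rewrite oppr0.
Qed.

Lemma L2B f g : L2 a b f -> L2 a b g -> L2 a b (fun t => f t - g t).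
Proof. by move=> f2 /L2N; exact: L2D. Qed.

Lemma L2norm_sqr_integral f :
  (L2norm a b f `^ 2 = \int[mu]_(t in `[a, b]) (f t ^+ 2)%:E)%E.
Proof.
rewrite poweR_Lnorm// [RHS]integral_mkcond; apply: eq_integral => t _ /=.
rewrite !patchE; case: ifPn => _; last by rewrite normr0 powR0.
by rewrite powR_mulrn// real_normK ?num_real.
Qed.

Lemma L2norm_fin_num f : L2 a b f -> L2norm a b f \is a fin_num.
Proof.
by move=> /andP[_]; rewrite inE => f2; rewrite ge0_fin_numE ?Lnorm_ge0.
Qed.

(** Square integrability makes the extended real norm finite, so that its square can be computed in
    the reals. *)
Lemma L2norm_sqr f : L2 a b f -> (L2norm a b f ^+ 2 = (L2dot a b f f)%:E)%E.
Proof.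
move=> f2; have := L2norm_sqr_integral f; rewrite /L2dot /Rintegral.
under [in X in _ = X -> _]eq_integral do rewrite expr2.
move=> <-; have := L2norm_fin_num f2.
have : (0 <= L2norm a b f)%E by exact: Lnorm_ge0.
case: (L2norm a b f) => //= r r0 _.
by rewrite powR_mulrn// expe2 -EFinM expr2.
Qed.

Lemma L2_poly p : L2 a b (fun t => p.[t]).
Proof.
have mp : measurable_fun [set: R] ((fun t => p.[t]) \_ `[a, b]).
  apply: (measurable_restrictT _ (measurable_itv _)).1.
  exact: measurable_poly.
apply/andP; split; rewrite inE//=.
rewrite /finite_norm unlock poweR_lty//.
rewrite [ltLHS](_ : _ = \int[mu]_(t in `[a, b]) `|((p ^+ 2).[t])%:E|)%E.
  by have /integrableP[] := integrable_poly a b (p ^+ 2).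
rewrite [RHS]integral_mkcond; apply: eq_integral => t _ /=.
rewrite !patchE; case: ifPn => _; last by rewrite normr0 powR0.
by rewrite powR_mulrn// real_normK ?num_real// horner_exp ger0_norm ?sqr_ge0.
Qed.

Lemma L2dotC f g : L2dot a b f g = L2dot a b g f.
Proof. by apply: eq_Rintegral => t _; rewrite mulrC. Qed.

Lemma L2dotDl f g h : L2 a b f -> L2 a b g -> L2 a b h ->
  L2dot a b (fun t => f t + g t) h = L2dot a b f h + L2dot a b g h.
Proof.
move=> f2 g2 h2; rewrite /L2dot -RintegralD//; try exact: L2_mul_integrable.
by apply: eq_Rintegral => t _; rewrite mulrDl.
Qed.

Lemma L2dotDr f g h : L2 a b f -> L2 a b g -> L2 a b h ->
  L2dot a b f (fun t => g t + h t) = L2dot a b f g + L2dot a b f h.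
Proof. by move=> *; rewrite L2dotC L2dotDl// 2!(L2dotC f). Qed.

Lemma L2dotZl c f g : L2 a b f -> L2 a b g ->
  L2dot a b (fun t => c * f t) g = c * L2dot a b f g.
Proof.
move=> f2 g2; rewrite /L2dot -RintegralZl//; last exact: L2_mul_integrable.
by apply: eq_Rintegral => t _; rewrite mulrA.
Qed.

Lemma L2dotNl f g : L2 a b f -> L2 a b g ->
  L2dot a b (fun t => - f t) g = - L2dot a b f g.
Proof.
move=> f2 g2; rewrite -mulN1r -L2dotZl//.
by apply: eq_Rintegral => t _; rewrite mulN1r.
Qed.

Lemma L2dot_polyD p q h : L2 a b h ->
  L2dot a b (fun t => (p + q).[t]) h =
  L2dot a b (fun t => p.[t]) h + L2dot a b (fun t => q.[t]) h.
Proof.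
move=> h2; rewrite -L2dotDl//; try exact: L2_poly.
by apply: eq_Rintegral => t _; rewrite hornerD.
Qed.

Lemma L2dot_polyZ c p h : L2 a b h ->
  L2dot a b (fun t => (c *: p).[t]) h = c * L2dot a b (fun t => p.[t]) h.
Proof.
move=> h2; rewrite -L2dotZl//; last exact: L2_poly.
by apply: eq_Rintegral => t _; rewrite hornerZ.
Qed.

Lemma L2dot_poly_sum (I : Type) (r : seq I) (P : pred I) (F : I -> {poly R}) h :
  L2 a b h ->
  L2dot a b (fun t => (\sum_(i <- r | P i) F i).[t]) h =
  \sum_(i <- r | P i) L2dot a b (fun t => (F i).[t]) h.
Proof.
move=> h2; apply: (big_ind2 (fun p x => L2dot a b (fun t => p.[t]) h = x)) => //.
- rewrite /L2dot; under eq_Rintegral do rewrite horner0 mul0r.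
  by rewrite Rintegral_cst//= mul0r.
- by move=> p x q y <- <-; rewrite L2dot_polyD.
Qed.

Lemma L2_pythagoras f g : L2 a b f -> L2 a b g -> L2dot a b f g = 0 ->
  L2dot a b (fun t => f t + g t) (fun t => f t + g t) =
  L2dot a b f f + L2dot a b g g.
Proof.
move=> f2 g2 fg; rewrite L2dotDl ?L2dotDr//; last exact: L2D.
by rewrite (L2dotC g f) fg addr0 add0r.
Qed.

Lemma L2dot_ge0 f : 0 <= L2dot a b f f.
Proof. by apply: Rintegral_ge0 => t _; rewrite -expr2 sqr_ge0. Qed.

End SquareIntegrable.

(** * Legendre expansions and best approximation by polynomials *)

Section LegendreExpansion.
Variable R : realType.
Variables (a b : R) (p : nat -> {poly R}).
Hypothesis hp : legendre a b p.
Implicit Types (f : R -> R) (q : {poly R}) (m : nat) (c : nat -> R).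

Definition legendre_sum m c : {poly R} := \sum_(k < m) c k *: p k.

Lemma size_legendre_sum m c : (size (legendre_sum m c) <= m)%N.
Proof.
have [sp _ _] := hp.
apply: (leq_trans (size_sum _ _ _)); apply/bigmax_leqP => i _.
by rewrite (leq_trans (size_scale_leq _ _))// sp.
Qed.

Lemma L2dot_legendre_sum m c f : L2 a b f ->
  L2dot a b (fun t => (legendre_sum m c).[t]) f =
  \sum_(k < m) c k * L2dot a b (fun t => (p k).[t]) f.
Proof.
by move=> f2; rewrite L2dot_poly_sum//; apply: eq_bigr => k _; rewrite L2dot_polyZ.
Qed.

Lemma L2dot_legendre_coef m c (k : 'I_m) :
  L2dot a b (fun t => (legendre_sum m c).[t]) (fun t => (p k).[t]) = c k.
Proof.
have [_ _ orth] := hp.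
rewrite L2dot_legendre_sum; last exact: L2_poly.
rewrite (bigD1 k)//= orth eqxx mulr1 big1 ?addr0// => l lk.
by rewrite orth (_ : (_ == _) = false) ?mulr0//; exact: negbTE.
Qed.

(** Induction on [m]: a multiple of [p m], whose leading coefficient is nonzero, cancels the
    coefficient of degree [m]. *)
Lemma legendre_span m q : (size q <= m)%N -> exists c, q = legendre_sum m c.
Proof.
have [sp lp _] := hp.
elim: m q => [|m IH] q.
  rewrite size_poly_leq0 => /eqP ->; exists (fun=> 0).
  by rewrite /legendre_sum big_ord0.
move=> sq; pose d := q`_m / lead_coef (p m).
have sq' : (size (q - d *: p m)%R <= m)%N.
  apply/leq_sizeP => j; rewrite leq_eqVlt => /orP[/eqP <-|mj].
  - have pm : (p m)`_m = lead_coef (p m) by rewrite lead_coefE sp.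
    by rewrite coefB coefZ pm /d divfK ?subrr// gt_eqF.
  - rewrite coefB coefZ !nth_default ?mulr0 ?subr0 ?sp//.
    exact: leq_trans sq _.
have [c qc] := IH _ sq'.
exists (fun k => if k == m then d else c k).
rewrite /legendre_sum big_ord_recr/= eqxx -[LHS](subrK (d *: p m)) qc.
congr (_ + _); apply: eq_bigr => k _.
by rewrite ltn_eqF.
Qed.

Lemma L2dot_legendre_sum_sqr m c :
  L2dot a b (fun t => (legendre_sum m c).[t]) (fun t => (legendre_sum m c).[t]) =
  \sum_(k < m) c k ^+ 2.
Proof.
rewrite L2dot_legendre_sum; last exact: L2_poly.
by apply: eq_bigr => k _; rewrite L2dotC L2dot_legendre_coef.
Qed.

(** The partial sum with coefficients [d] and [f] have the same inner product with each [p k],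
    [k < m], so their difference is orthogonal to [V_m]. *)
Lemma legendre_sum_orth m c d f : L2 a b f ->
  (forall k, (k < m)%N -> d k = L2dot a b f (fun t => (p k).[t])) ->
  L2dot a b (fun t => (legendre_sum m c).[t])
    (fun t => (legendre_sum m d).[t] - f t) = 0.
Proof.
move=> f2 dE; rewrite L2dot_legendre_sum; last by apply: L2B => //; exact: L2_poly.
rewrite big1// => k _; rewrite L2dotC L2dotDl ?L2dotNl//; try exact: L2_poly.
- by rewrite L2dot_legendre_coef dE// subrr mulr0.
- exact: L2N.
Qed.

(** [q - f] is the sum of an element of [V_m] and of the error of the Legendre partial sum, which
    are orthogonal. An error bound for any [q] in [V_m] thus passes to the partial sum. *)
Lemma legendre_sum_best m d f q : L2 a b f -> (size q <= m)%N ->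
  (forall k, (k < m)%N -> d k = L2dot a b f (fun t => (p k).[t])) ->
  L2dot a b (fun t => (legendre_sum m d).[t] - f t)
            (fun t => (legendre_sum m d).[t] - f t) <=
  L2dot a b (fun t => q.[t] - f t) (fun t => q.[t] - f t).
Proof.
move=> f2 sq dE.
have : (size (q - legendre_sum m d)%R <= m)%N.
  by rewrite (leq_trans (size_polyD _ _))// geq_max sq size_polyN size_legendre_sum.
case/legendre_span => c qc.
rewrite [leRHS](_ : _ =
  L2dot a b (fun t => (legendre_sum m c).[t] + ((legendre_sum m d).[t] - f t))
            (fun t => (legendre_sum m c).[t] + ((legendre_sum m d).[t] - f t))).
  rewrite (L2_pythagoras _ _ (legendre_sum_orth c f2 dE)).
  - by rewrite lerDr L2dot_ge0.
  - exact: L2_poly.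
  - by apply: L2B => //; exact: L2_poly.
by apply: eq_Rintegral => t _; rewrite -qc hornerD hornerN addrA subrK.
Qed.

(** Pythagoras. With estimated coefficients [c] and true ones [d], only the first sum depends on the
    sample; the other term is the squared bias. *)
Lemma L2norm_legendre_sum_sqr m c d f : L2 a b f ->
  (forall k, (k < m)%N -> d k = L2dot a b f (fun t => (p k).[t])) ->
  (L2norm a b (fun t => ((legendre_sum m c).[t] - f t)%R) ^+ 2 =
   (\sum_(k < m) (c k - d k) ^+ 2 +
    L2dot a b (fun t => (legendre_sum m d).[t] - f t)
              (fun t => (legendre_sum m d).[t] - f t))%:E)%E.
Proof.
move=> f2 dE; rewrite L2norm_sqr; last by apply: L2B => //; exact: L2_poly.
congr EFin; rewrite -(L2dot_legendre_sum_sqr m (fun k => c k - d k)).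
rewrite -(L2_pythagoras _ _ (legendre_sum_orth (fun k => c k - d k) f2 dE)).
- apply: eq_Rintegral => t _.
  suff -> : legendre_sum m (fun k => c k - d k) =
            legendre_sum m c - legendre_sum m d by rewrite hornerD hornerN addrA subrK.
  by rewrite -sumrB; apply: eq_bigr => k _; rewrite scalerBl.
- exact: L2_poly.
- by apply: L2B => //; exact: L2_poly.
Qed.

End LegendreExpansion.

(** * Change of scale in a Lebesgue integral *)

Section ScalingDensity.
Variable R : realType.
Notation mu := (@lebesgue_measure R).

(** Lebesgue measure is [s] times its image under multiplication by [s]: by uniqueness it is enough
    to compare them on half-open intervals. *)
Lemma ge0_integral_lebesgue_scale (s : R) (f : R -> \bar R) : 0 < s ->
  measurable_fun [set: R] f -> (forall x, (0 <= f x)%E) ->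
  (\int[mu]_x f x = \int[mu]_x (s%:E * f (s * x)%R))%E.
Proof.
move=> s0 mf f0; have ms : measurable_fun [set: R] (fun x : R => s * x).
  exact: mulrl_measurable.
pose phi (x : measurableTypeR R) : measurableTypeR R := s * x.
have mphi : measurable_fun [set: measurableTypeR R] phi by [].
pose push : {measure set (measurableTypeR R) -> \bar R} := pushforward mu phi.
pose nu : {measure set (measurableTypeR R) -> \bar R} :=
  mscale (NngNum (ltW s0)) (push mphi).
have muE A : measurable A -> mu A = nu A.
  move: A; apply: lebesgue_measure_unique => _ [[u v] _ <-].
  transitivity (s%:E * mu `](s^-1 * u)%R, (s^-1 * v)%R]%classic)%E; last first.
    congr (_ * mu _)%E; apply/seteqP; split => x /=; rewrite !in_itv/=.
      by rewrite ltr_pdivrMl// ler_pdivlMl.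
    by rewrite ltr_pdivrMl// ler_pdivlMl.
  rewrite !lebesgue_measure_itv/= !lte_fin ltr_pM2l ?invr_gt0//.
  case: ifPn => uv; last by rewrite mule0.
  by rewrite -!EFinB -EFinM -mulrBr mulVKf// gt_eqF.
rewrite (eq_measure_integral nu); last by move=> A mA _; exact: muE.
rewrite ge0_integral_mscale// ge0_integral_pushforward// preimage_setT.
rewrite ge0_integralZl//.
- exact: measurableT_comp.
- by rewrite lee_fin ltW.
Qed.

End ScalingDensity.

(** * Integration against a measure with a density *)

Section Density.
Local Open Scope ereal_scope.
Context d (T : measurableType d) (R : realType).
Variables (nu : {finite_measure set T -> \bar R})
          (mu : {sigma_finite_measure set T -> \bar R}) (h : T -> \bar R).
Hypothesis mh : measurable_fun [set: T] h.
Hypothesis nuE : forall B, measurable B -> nu B = \int[mu]_(x in B) h x.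

(** [nu] vanishes on the null sets of [mu], and [h] agrees almost everywhere with the Radon-Nikodym
    derivative because both have the same integral over every measurable set. *)
Lemma ge0_integral_density (f : T -> \bar R) :
  measurable_fun [set: T] f -> (forall x, 0 <= f x) ->
  \int[nu]_x f x = \int[mu]_x (f x * h x).
Proof.
move=> mf f0; have numu : nu `<< mu.
  apply/null_content_dominatesP => A mA muA; rewrite nuE//.
  by apply: null_set_integral => //; exact: measurable_funTS.
rewrite -(Radon_Nikodym_SigmaFinite.change_of_variables numu f0)//.
have mg := measurable_int _ (Radon_Nikodym_SigmaFinite.f_integrable numu).
apply: ae_eq_integral => //; try exact: emeasurable_funM.
apply: ae_eqe_mul2l; apply: integral_ae_eq => //.
- exact: Radon_Nikodym_SigmaFinite.f_integrable.
- by move=> E _ mE; rewrite -nuE// -Radon_Nikodym_SigmaFinite.f_integral.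
Qed.

End Density.

(** * Expectations under the mixture density *)

Section MixtureLaw.
Variable R : realType.
Variables (a b : R) (pi1 f : R -> R).
Hypothesis a0 : 0 < a.
Hypothesis mpi1 : measurable_fun [set: R] pi1.
Hypothesis pi1_ge0 : forall x, 0 <= pi1 x.
Hypothesis mf : measurable_fun [set: R] (f \_ `[a, b]).
Notation mu := (@lebesgue_measure R).
Hypothesis f_ge0 : {ae mu, forall t, t \in `[a, b] -> 0 <= f t}.

(** [f] is nonnegative only almost everywhere on [[a, b]]; this version is nonnegative everywhere,
    as Tonelli's theorem requires. *)
Definition pos_restr (t : R) : R := Num.max ((f \_ `[a, b]) t) 0.

Lemma measurable_pos_restr : measurable_fun [set: R] pos_restr.
Proof. exact: measurable_maxr. Qed.

Lemma pos_restr_ge0 t : 0 <= pos_restr t.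
Proof. by rewrite /pos_restr le_max lexx orbT. Qed.

Lemma pos_restr_out t : t \notin `[a, b] -> pos_restr t = 0.
Proof.
move=> tab; rewrite /pos_restr patchE ifF ?maxxx//.
by apply/negbTE; rewrite notin_setE/=; exact/negP.
Qed.

Lemma pos_restr_ae : ae_eq mu [set: R] pos_restr (f \_ `[a, b]).
Proof.
apply: (@filterS _ _ (ae_filter_ringOfSetsType mu)) f_ge0 => t ft _.
rewrite /pos_restr patchE; case: ifPn => [tab|_].
  by apply: max_l; apply: ft; move: tab; rewrite inE.
exact: maxxx.
Qed.

(* [t `^ -1] is [t^-1] for [0 < t], and is measurable on the whole line. *)
Definition mixture_kernel (t x : R) : R :=
  pos_restr t * (t `^ (-1) * pi1 (t `^ (-1) * x)).

Lemma measurable_inv_scaled d (T : measurableType d) (u v : T -> R) :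
  measurable_fun [set: T] u -> measurable_fun [set: T] v ->
  measurable_fun [set: T] (fun z => u z `^ (-1) * pi1 (u z `^ (-1) * v z)).
Proof.
move=> mu' mv; have mi : measurable_fun [set: T] (fun z => u z `^ (-1)).
  exact: measurableT_comp (measurable_powR (-1)) mu'.
apply: measurable_funM => //; apply: measurableT_comp => //.
exact: measurable_funM.
Qed.

Lemma mixtureE x : mixture a b pi1 f x = (\int[mu]_t (mixture_kernel t x)%:E)%E.
Proof.
rewrite /mixture integral_mkcond.
have mk : measurable_fun [set: R] (fun t : R => t `^ (-1) * pi1 (t `^ (-1) * x)).
  exact: measurable_inv_scaled.
transitivity (\int[mu]_t
    ((f \_ `[a, b]) t * (t `^ (-1) * pi1 (t `^ (-1) * x)))%:E)%E.
  apply: eq_integral => t _; rewrite !patchE; case: ifPn => [|_]; last by rewrite mul0r.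
  rewrite inE/= in_itv/= => /andP[ta _].
  by rewrite powR_inv1 // ltW// (lt_le_trans a0).
apply: ae_eq_integral => //.
- by apply/measurable_EFinP; exact: measurable_funM.
- apply/measurable_EFinP; apply: measurable_funM => //.
  exact: measurable_pos_restr.
- by apply: filterS pos_restr_ae => t /(_ I) ft _; rewrite /mixture_kernel ft.
Qed.

Lemma measurable_mixture_kernel :
  measurable_fun [set: measurableTypeR R * measurableTypeR R]
    (fun z => (mixture_kernel z.1 z.2)%:E).
Proof.
apply/measurable_EFinP; apply: measurable_funM.
  exact: measurableT_comp measurable_pos_restr measurable_fst.
exact: measurable_inv_scaled.
Qed.

Lemma mixture_kernel_ge0 t x : 0 <= mixture_kernel t x.
Proof. by rewrite !mulr_ge0 ?pos_restr_ge0 ?powR_ge0. Qed.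

Lemma measurable_mixture : measurable_fun [set: R] (mixture a b pi1 f).
Proof.
rewrite (_ : mixture a b pi1 f = fun x => \int[mu]_t (mixture_kernel t x)%:E)%E.
  apply: (measurable_fun_fubini_tonelli_G (m1 := mu) _ measurable_mixture_kernel).
  by move=> z; rewrite lee_fin mixture_kernel_ge0.
by apply/funext => x; exact: mixtureE.
Qed.

(** Substituting [t * x] for [x] turns the scaled density into [pi1], the Jacobian [t] cancelling
    the factor [t^-1]. For [t] outside [[a, b]] both sides are 0. *)
Lemma integral_mixture_kernel (phi : R -> R) t :
  measurable_fun [set: R] phi -> (forall x, 0 <= phi x) ->
  (\int[mu]_x (phi x * mixture_kernel t x)%:E =
   (pos_restr t)%:E * \int[mu]_x (phi (t * x) * pi1 x)%:E)%E.
Proof.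
move=> mphi phi0; have [tab|tab] := boolP (t \in `[a, b]); last first.
  rewrite pos_restr_out// mul0e integral0_eq// => x _.
  by rewrite /mixture_kernel pos_restr_out// mul0r mulr0.
have t0 : 0 < t.
  by move: tab; rewrite in_itv/= => /andP[ta _]; exact: lt_le_trans ta.
have mpt : measurable_fun [set: R] (fun x => phi (t * x) * pi1 x).
  apply: measurable_funM => //; apply: measurableT_comp => //.
rewrite (ge0_integral_lebesgue_scale t0); last 2 first.
- apply/measurable_EFinP; apply: measurable_funM => //.
  apply: measurable_funM => //; exact: measurable_inv_scaled.
- by move=> x; rewrite lee_fin mulr_ge0// mixture_kernel_ge0.
rewrite -ge0_integralZl//.
- apply: eq_integral => x _; rewrite -!EFinM; congr EFin.
  rewrite /mixture_kernel powR_inv1 ?ltW// mulKf ?gt_eqF//.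
  by field; rewrite gt_eqF.
- exact/measurable_EFinP.
- by move=> x _; rewrite lee_fin mulr_ge0.
- by rewrite lee_fin pos_restr_ge0.
Qed.

Context d (T : measurableType d) (P : probability T R) (X : {RV P >-> R}).
Hypothesis Xh : has_density X (mixture a b pi1 f).

(** [X] is distributed as the product of independent variables with densities [f] and [pi1]. The
    formula follows by exchanging the integrals over [x] and [t]. *)
Lemma ge0_expectation_mixture (phi : R -> R) :
  measurable_fun [set: R] phi -> (forall x, 0 <= phi x) ->
  (\int[P]_w (phi (X w))%:E =
   \int[mu]_t ((pos_restr t)%:E * \int[mu]_x (phi (t * x) * pi1 x)%:E))%E.
Proof.
move=> mphi phi0.
have mphiE : measurable_fun [set: measurableTypeR R] (fun x => (phi x)%:E).
  exact/measurable_EFinP.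
(* [lebesgue_measure] lives on [measurableTypeR R], whose display is not that of
   [R], so the law of [X] has to be transported there. *)
pose X0 : T -> measurableTypeR R := X.
have mX : measurable_fun [set: T] X by exact: measurable_funPT.
have mX0 : measurable_fun [set: T] X0 := mX.
pose X1 : {RV P >-> measurableTypeR R} :=
  HB.pack X0 (isMeasurableFun.Build _ _ T (measurableTypeR R) X0 mX0).
have phiE0 (x : measurableTypeR R) : (0 <= (phi x)%:E)%E by rewrite lee_fin.
have -> : (\int[P]_w (phi (X w))%:E = \int[distribution P X1]_x (phi x)%:E)%E.
  by rewrite (ge0_integral_distribution X1 mphiE phiE0).
rewrite (@ge0_integral_density _ _ _ (distribution P X1) mu _ measurable_mixture
  Xh _ mphiE)//.
transitivity (\int[mu]_x \int[mu]_t (phi x * mixture_kernel t x)%:E)%E.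
  apply: eq_integral => x _; rewrite mixtureE -ge0_integralZl//.
  - apply/measurable_EFinP; apply: measurable_funM; first exact: measurable_pos_restr.
    exact: measurable_inv_scaled.
  - by move=> t _; rewrite lee_fin mixture_kernel_ge0.
rewrite -(fubini_tonelli (m1 := mu) (m2 := mu)
  (fun z => (phi z.2 * mixture_kernel z.1 z.2)%:E))/=.
- by apply: eq_integral => t _; exact: integral_mixture_kernel.
- apply/measurable_EFinP; apply: measurable_funM.
    exact: measurableT_comp mphi measurable_snd.
  by have /measurable_EFinP := measurable_mixture_kernel.
- by move=> z; rewrite lee_fin mulr_ge0// mixture_kernel_ge0.
Qed.

End MixtureLaw.

(** * Support and moments of [pi1] *)

Section Support.
Variable R : realType.
Variable pi1 : R -> R.
Hypothesis hpi1 : density pi1.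
Hypothesis hsupp : compact_support_nonneg pi1.
Notation mu := (@lebesgue_measure R).

Definition moment (j : nat) : R := Rintegral mu [set: R] (fun y => y ^+ j * pi1 y).

Lemma density_support :
  exists2 M : R, 0 < M & forall x, pi1 x != 0 -> 0 <= x <= M.
Proof.
have [cpt ge0] := hsupp; have [M [_ hM]] := compact_bounded cpt.
(* The bound holds for every number strictly above [M], and [M] may be negative. *)
exists (`|M| + 1); first by rewrite ltr_pwDr.
move=> x x0; have cx : closure [set x | pi1 x != 0] x by exact: subset_closure.
have {}ge0 : 0 <= x by exact: ge0.
rewrite ge0/= -(ger0_norm ge0); apply: hM => //.
by rewrite ltr_pwDr// ler_norm.
Qed.

Lemma measurable_power_density j : measurable_fun [set: R] (fun y => y ^+ j * pi1 y).
Proof.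
have [mpi1 _ _] := hpi1.
by apply: measurable_funM => //; exact: exprn_measurable.
Qed.

Lemma moment_integrable j :
  mu.-integrable [set: R] (fun y => (y ^+ j * pi1 y)%:E).
Proof.
have [mpi1 pi10 ipi1] := hpi1; have [M M0 hM] := density_support.
have ig : mu.-integrable [set: R] (fun y => (M ^+ j * pi1 y)%:E).
  under eq_fun do rewrite EFinM.
  apply: integrableZl => //; apply/integrableP; split; first exact/measurable_EFinP.
  rewrite (_ : (\int[mu]_y _ = 1)%E) ?ltry// -[RHS]ipi1.
  by apply: eq_integral => y _; rewrite gee0_abs// lee_fin.
apply: le_integrable ig => //.
  by apply/measurable_EFinP; exact: measurable_power_density.
move=> y _ /=; rewrite lee_fin !normrM (ger0_norm (pi10 y)).
have [->|y0] := eqVneq (pi1 y) 0; first by rewrite !mulr0.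
have /andP[y1 y2] := hM _ y0.
rewrite ler_wpM2r// normrX (ger0_norm y1) ger0_norm ?exprn_ge0 ?(ltW M0)//.
by rewrite lerXn2r ?nnegrE// ltW.
Qed.

(** The absolute value makes the integrand nonnegative on the whole line and changes nothing on the
    support of [pi1]. *)
Lemma ge0_momentE j :
  (\int[mu]_y (`|y| ^+ j * pi1 y)%:E = (moment j)%:E)%E.
Proof.
have [M M0 hM] := density_support.
rewrite /moment /Rintegral fineK; last first.
  by apply: integrable_fin_num => //; exact: moment_integrable.
apply: eq_integral => y _; have [->|y0] := eqVneq (pi1 y) 0; first by rewrite !mulr0.
by have /andP[y1 _] := hM _ y0; rewrite ger0_norm.
Qed.

Lemma moment0 : moment 0 = 1.
Proof.
have [_ _ ipi1] := hpi1; rewrite /moment /Rintegral.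
by under eq_integral do rewrite expr0 mul1r; rewrite ipi1.
Qed.

(** If it were 0, then [y * pi1 y] and hence [pi1 y] would vanish for almost all [y], against total
    mass 1. *)
Lemma moment1_gt0 : 0 < moment 1.
Proof.
have [mpi1 pi10 ipi1] := hpi1; have [M M0 hM] := density_support.
rewrite lt_neqAle; apply/andP; split; last first.
  apply: Rintegral_ge0 => y _; have [->|y0] := eqVneq (pi1 y) 0; first by rewrite mulr0.
  by have /andP[y1 _] := hM _ y0; rewrite mulr_ge0.
apply/eqP => m0; have := ge0_momentE 1; rewrite -m0 => i0.
have h : (\int[mu]_y `|(`|y| ^+ 1 * pi1 y)%:E| = 0)%E.
  rewrite -[RHS]i0; apply: eq_integral => y _.
  by rewrite gee0_abs// lee_fin mulr_ge0.
have mh : measurable_fun [set: measurableTypeR R] (fun y => (`|y| ^+ 1 * pi1 y)%:E).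
  apply/measurable_EFinP; apply: measurable_funM => //.
  by apply: measurable_funX; exact: normr_measurable.
have ae0 := (ae_eq_integral_abs mu measurableT mh).1 h.
have ne0 : {ae mu, forall y : R, y != 0}.
  exists [set 0]; split => //; first exact: lebesgue_measure_set1.
  by move=> y /= /negP; rewrite negbK => /eqP.
have : (\int[mu]_x (pi1 x)%:E = \int[mu]_x (cst 0%E x))%E.
  apply: ae_eq_integral => //; first exact/measurable_EFinP.
  apply: (@filterS2 _ _ (ae_filter_ringOfSetsType mu)) ae0 ne0 => y h1 h2 _.
  have /eqP := h1 I; rewrite eqe expr1 mulf_eq0 normr_eq0 (negbTE h2)/=.
  by move/eqP => ->.
by rewrite integral0 ipi1 => /eqP; rewrite onee_eq0.
Qed.

(** The left side is the tangent at [m] of a convex power. In the induction the excess is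
    [j.+1 * m ^ j * (x - m) ^ 2]. *)
Lemma expr_tangent (m x : R) j : 0 <= m -> 0 <= x ->
  j.+1%:R * m ^+ j * x - j%:R * m ^+ j.+1 <= x ^+ j.+1.
Proof.
move=> m0 x0; elim: j => [|j IH]; first by rewrite expr0 !mul1r mul0r subr0 expr1.
rewrite [leRHS]exprS; apply: le_trans (ler_wpM2l x0 IH).
rewrite -subr_ge0; have -> : x * (j.+1%:R * m ^+ j * x - j%:R * m ^+ j.+1) -
  (j.+2%:R * m ^+ j.+1 * x - j.+1%:R * m ^+ j.+2) = j.+1%:R * m ^+ j * (x - m) ^+ 2.
  by rewrite !exprS -[j.+2]addn1 -[j.+1]addn1 !natrD; ring.
by rewrite mulr_ge0 ?sqr_ge0// mulr_ge0 ?exprn_ge0.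
Qed.

(* Jensen: integrate the tangent line of [y ^+ j] at [y = moment 1]. *)
Lemma moment_ge j : moment 1 ^+ j <= moment j.
Proof.
case: j => [|j]; first by rewrite moment0.
have [mpi1 pi10 ipi1] := hpi1; have [M M0 hM] := density_support.
have m0 := ltW moment1_gt0.
pose c := j.+1%:R * moment 1 ^+ j; pose e := j%:R * moment 1 ^+ j.+1.
have i1 : mu.-integrable [set: R] (fun y => (c * (y ^+ 1 * pi1 y))%:E).
  by under eq_fun do rewrite EFinM; apply: integrableZl => //; exact: moment_integrable.
have i0 : mu.-integrable [set: R] (fun y => (e * (y ^+ 0 * pi1 y))%:E).
  by under eq_fun do rewrite EFinM; apply: integrableZl => //; exact: moment_integrable.
have -> : moment 1 ^+ j.+1 =
    \int[mu]_y (c * (y ^+ 1 * pi1 y) - e * (y ^+ 0 * pi1 y)).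
  rewrite RintegralB// [X in X - _]RintegralZl//; last exact: moment_integrable.
  rewrite [X in _ - X]RintegralZl//; last exact: moment_integrable.
  rewrite -/(moment 1) -/(moment 0) moment0 /c /e exprS -natr1; ring.
apply: le_Rintegral => //.
- by have := integrableB measurableT i1 i0.
- exact: moment_integrable.
- move=> y _; have [->|y0] := eqVneq (pi1 y) 0; first by rewrite !mulr0 subr0.
  have /andP[y1 _] := hM _ y0.
  rewrite expr1 expr0 mul1r mulrA -mulrBl ler_wpM2r//.
  exact: expr_tangent.
Qed.

End Support.

(** * Range, moments and unbiased statistics of one observation *)

Section SampleMoments.
Variable R : realType.
Variables (a b : R) (pi1 f : R -> R).
Hypothesis a0 : 0 < a.
Hypothesis hpi1 : density pi1.
Hypothesis hsupp : compact_support_nonneg pi1.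
Hypothesis Hf : H1 a b f.
Notation mu := (@lebesgue_measure R).
Context d (T : measurableType d) (P : probability T R) (X : {RV P >-> R}).
Hypothesis Xh : has_density X (mixture a b pi1 f).

Let f2 : L2 a b f. Proof. by have [] := Hf. Qed.
Let mf : measurable_fun [set: R] (f \_ `[a, b]).
Proof. by have /andP[] := f2; rewrite inE. Qed.
Let f_ge0 : {ae mu, forall t, t \in `[a, b] -> 0 <= f t}.
Proof. by have [] := Hf. Qed.
Let mpi1 : measurable_fun [set: R] pi1. Proof. by have [] := hpi1. Qed.
Let pi1_ge0 x : 0 <= pi1 x. Proof. by have [_ +] := hpi1; exact. Qed.

Let expectation_mixture := ge0_expectation_mixture a0 mpi1 pi1_ge0 mf f_ge0 Xh.

(** The expectation formula is applied to the indicator of the complement: [t] in [[a, b]] and [x]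
    in [[0, M]] give [t * x] in [[0, b * M]]. *)
Lemma sample_range (M : R) : (forall x, pi1 x != 0 -> 0 <= x <= M) ->
  {ae P, forall w, X w \in `[0, b * M]}.
Proof.
move=> hM; pose B : set R := ~` `[0, b * M].
have mB : measurable B by exact: measurableC.
pose I (x : R) : R := \1_B x.
have mI : measurable_fun [set: R] I by exact: measurable_indic.
have I0 x : 0 <= I x by [].
have i0 : (\int[P]_w (I (X w))%:E = 0)%E.
  rewrite (expectation_mixture mI)//; apply: integral0_eq => t _.
  have [tab|tab] := boolP (t \in `[a, b]); last first.
    by rewrite (pos_restr_out f tab) mul0e.
  rewrite integral0_eq ?mule0// => x _.
  have [->|x0] := eqVneq (pi1 x) 0; first by rewrite mulr0.
  rewrite /I indicE memNset ?mul0r// /B/=; apply; rewrite in_itv/=.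
  move: tab; rewrite in_itv/= => /andP[ta tb]; have /andP[x1 x2] := hM _ x0.
  by rewrite mulr_ge0 ?ler_pM// ?(le_trans (ltW a0)).
have mIX : measurable_fun [set: T] (fun w => (I (X w))%:E).
  by apply/measurable_EFinP; exact: measurableT_comp.
have ia : (\int[P]_w `|(I (X w))%:E| = 0)%E.
  by rewrite -[RHS]i0; apply: eq_integral => w _; rewrite gee0_abs// lee_fin.
apply: filterS ((ae_eq_integral_abs P measurableT mIX).1 ia) => w /(_ Logic.I)/eqP.
rewrite eqe; apply: contraTT => Xw.
by rewrite /I indicE mem_set ?oner_eq0// /B/=; exact/negP.
Qed.

(** Powers are multiplicative, so the inner integral in the expectation formula is [t ^ j] times the
    moment of [pi1]. *)
Lemma sample_moment j :
  (\int[P]_w (`|X w| ^+ j)%:E =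
   (moment pi1 j * L2dot a b f (fun t => t ^+ j))%:E)%E.
Proof.
have mj : measurable_fun [set: R] (fun x : R => `|x| ^+ j).
  by apply: measurable_funX; exact: normr_measurable.
rewrite (expectation_mixture mj); last by move=> x; rewrite exprn_ge0.
have L2j : L2 a b (fun t => t ^+ j).
  rewrite (_ : (fun t : R => _) = fun t => ('X^j).[t]); first exact: L2_poly.
  by apply/funext => t; rewrite hornerXn.
have fj := L2_mul_integrable f2 L2j.
transitivity (\int[mu]_t ((moment pi1 j * (pos_restr a b f t * t ^+ j))%:E))%E.
  apply: eq_integral => t _; have [tab|tab] := boolP (t \in `[a, b]); last first.
    by rewrite (pos_restr_out f tab) mul0e mul0r mulr0.
  have t0 : 0 <= t.
    by move: tab; rewrite in_itv/= => /andP[ta _]; exact: le_trans (ltW a0) ta.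
  rewrite (_ : \int[mu]_x _ =
      \int[mu]_x ((t ^+ j)%:E * (`|x| ^+ j * pi1 x)%:E))%E; last first.
    by apply: eq_integral => x _; rewrite normrM (ger0_norm t0) exprMn -EFinM mulrA.
  rewrite ge0_integralZl//.
  - by rewrite ge0_momentE// -!EFinM; congr EFin; ring.
  - by apply/measurable_EFinP; apply: measurable_funM.
  - by move=> x _; rewrite lee_fin mulr_ge0// exprn_ge0.
  - by rewrite lee_fin exprn_ge0.
have L2E : ((L2dot a b f (fun t => t ^+ j))%:E =
    \int[mu]_(t in `[a, b]) (f t * t ^+ j)%:E)%E.
  rewrite /L2dot /Rintegral fineK//.
  by apply: (integrable_fin_num _ fj); exact: measurable_itv.
rewrite EFinM L2E -integralZl//; rewrite [RHS]integral_mkcond.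
have mP := measurable_pos_restr mf.
apply: ae_eq_integral => //.
- apply/measurable_EFinP; apply: measurable_funM => //.
  by apply: measurable_funM => //; exact: exprn_measurable.
- apply: (measurable_restrictT _ (measurable_itv _)).1.
  by apply: measurable_funeM; exact: measurable_int fj.
- apply: (@filterS _ _ (ae_filter_ringOfSetsType mu)) (pos_restr_ae f_ge0).
  move=> t /(_ Logic.I) -> _.
  by rewrite !patchE; case: ifPn => _ //; rewrite mul0r mulr0.
Qed.

(** The contribution of one observation to an estimated Legendre coefficient, when [c] lists the
    coefficients of [p k]. *)
Definition stat (n : nat) (c : nat -> R) (x : R) : R := \sum_(j < n) c j * g pi1 j x.

(** Clipping makes the statistic bounded on the whole line; with [L = b * M] it changes it only on
    an event of probability 0. *)
Definition clipped_stat (L : R) (n : nat) (c : nat -> R) (x : R) : R :=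
  stat n c x * \1_`[0, L] x.

Lemma measurable_clipped_stat L n c : measurable_fun [set: R] (clipped_stat L n c).
Proof.
apply: measurable_funM; last exact: measurable_indic.
apply: measurable_sum => j; apply: measurable_funM => //.
apply: measurable_funM => //; exact: exprn_measurable.
Qed.

(** On [[0, L]], Jensen's bound on the moments gives [g j x <= (L / moment 1) ^ j]. The maximum with
    1 allows the exponent [j] to be raised to [n]. *)
Lemma clipped_stat_bound L n c x : 0 <= L ->
  `|clipped_stat L n c x| <=
  (\sum_(j < n) `|c j|) * (Num.max 1 (L / moment pi1 1)) ^+ n.
Proof.
move=> L0; set G := Num.max _ _; have m0 := moment1_gt0 hpi1 hsupp.
have G1 : 1 <= G by rewrite le_max lexx.
have G0 : 0 <= G by exact: le_trans G1.
have S0 : 0 <= \sum_(j < n) `|c j| by exact: sumr_ge0.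
rewrite /clipped_stat indicE; have [xL|_] := boolP (x \in _); last first.
  by rewrite mulr0 normr0 mulr_ge0// exprn_ge0.
rewrite mulr1; move: xL; rewrite inE/= in_itv/= => /andP[x0 xL].
apply: (le_trans (ler_norm_sum _ _ _)); rewrite mulr_suml; apply: ler_sum => j _.
rewrite normrM ler_wpM2l// (@le_trans _ _ (G ^+ j))//; last first.
  by rewrite ler_weXn2l// ltnW.
have mj : 0 < moment pi1 1 ^+ j by rewrite exprn_gt0.
have mjj := moment_ge hpi1 hsupp j.
have mj0 : 0 < moment pi1 j by exact: lt_le_trans mjj.
rewrite /g -/(moment pi1 j) normrM normfV (gtr0_norm mj0) mulrC.
rewrite (@le_trans _ _ (L ^+ j / moment pi1 1 ^+ j))//.
  apply: ler_pM => //; first by rewrite invr_ge0 ltW.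
    by rewrite ger0_norm ?exprn_ge0// lerXn2r.
  by rewrite lef_pV2.
rewrite -expr_div_n lerXn2r ?nnegrE// ?divr_ge0// ?(ltW m0)//.
by rewrite le_max lexx orbT.
Qed.

Lemma clipped_statE M n c : (forall x, pi1 x != 0 -> 0 <= x <= M) ->
  {ae P, forall w, clipped_stat (b * M) n c (X w) = stat n c (X w)}.
Proof.
move=> hM; apply: filterS (sample_range hM) => w Xw.
by rewrite /clipped_stat indicE mem_set ?mulr1.
Qed.

(** Unbiasedness: the normalization in [g] cancels the moment of [pi1] produced by the scale
    mixture. *)
Lemma expectation_clipped_stat M n c : (forall x, pi1 x != 0 -> 0 <= x <= M) ->
  (\int[P]_w (clipped_stat (b * M) n c (X w))%:E =
   (\sum_(j < n) c j * L2dot a b f (fun t => t ^+ j))%:E)%E.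
Proof.
move=> hM; have mX : measurable_fun [set: T] X by exact: measurable_funPT.
pose e j := (moment pi1 j)^-1 * c j.
have ae_range := sample_range hM.
have ij j : P.-integrable [set: T] (fun w => (`|X w| ^+ j)%:E).
  apply/integrableP; split.
    by apply/measurable_EFinP; apply: measurable_funX; exact: measurableT_comp.
  rewrite (eq_integral (fun w => (`|X w| ^+ j)%:E)) ?sample_moment ?ltry// => w _.
  by rewrite gee0_abs// lee_fin exprn_ge0.
transitivity (\int[P]_w (\sum_(j < n) (e j)%:E * (`|X w| ^+ j)%:E))%E.
  apply: ae_eq_integral => //.
  - apply/measurable_EFinP; apply: measurableT_comp => //.
    exact: measurable_clipped_stat.
  - apply: emeasurable_sum => j; apply: measurable_funeM.
    exact: measurable_int (ij j).
  - apply: filterS2 ae_range (clipped_statE n c hM) => w.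
    rewrite in_itv/= => /andP[X0 _] -> _.
    rewrite -sumEFin; apply: eq_bigr => j _; rewrite -EFinM; congr EFin.
    by rewrite /g -/(moment pi1 j) /e (ger0_norm X0); ring.
rewrite integral_sum//; last by move=> j; exact: integrableZl.
rewrite -sumEFin; apply: eq_bigr => j _.
rewrite integralZl// sample_moment -EFinM /e; congr EFin.
have mj : moment pi1 j != 0.
  apply: lt0r_neq0; apply: lt_le_trans (moment_ge hpi1 hsupp j).
  by rewrite exprn_gt0// moment1_gt0.
by field.
Qed.

End SampleMoments.

(** * Independence and the variance of an empirical mean *)

Section Independence.
Variable R : realType.
Context d (T : measurableType d) (P : probability T R).

Lemma bounded_expectation_integrable (Z : T -> R) (B : R) :
  measurable_fun [set: T] Z -> (forall w, `|Z w| <= B) ->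
  P.-integrable [set: T] (fun w => (Z w)%:E).
Proof.
move=> mZ ZB; apply: measurable_bounded_integrable => //.
  by rewrite [ltLHS]probability_setT ltry.
exists B; split; first exact: num_real.
by move=> M BM w _ /=; rewrite (le_trans (ZB w))// ltW.
Qed.

(** The joint law agrees with the product of the laws on rectangles, hence on all measurable sets,
    and Fubini's theorem applies to the bounded integrand. *)
Lemma expectation_indep_mul (X Y : {RV P >-> R}) (u v : R -> R) (B : R) :
  (forall A C, measurable A -> measurable C ->
     (P (X @^-1` A `&` Y @^-1` C) = P (X @^-1` A) * P (Y @^-1` C))%E) ->
  measurable_fun [set: R] u -> measurable_fun [set: R] v ->
  (forall x, `|u x| <= B) -> (forall x, `|v x| <= B) ->
  (\int[P]_w (u (X w) * v (Y w))%:E =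
   \int[P]_w (u (X w))%:E * \int[P]_w (v (Y w))%:E)%E.
Proof.
move=> indep mu mv uB vB.
have mX : measurable_fun [set: T] X by exact: measurable_funPT.
have mY : measurable_fun [set: T] Y by exact: measurable_funPT.
pose Z w := (X w, Y w).
have mZ : measurable_fun [set: T] Z by exact: measurable_fun_pair.
pose push : {measure set (R * R) -> \bar R} := pushforward P Z.
pose F (z : R * R) := (u z.1 * v z.2)%:E.
have mF : measurable_fun [set: R * R] F.
  apply/measurable_EFinP; apply: measurable_funM.
    exact: measurableT_comp mu measurable_fst.
  exact: measurableT_comp mv measurable_snd.
have FB z : `|u z.1 * v z.2| <= B * B by rewrite normrM ler_pM.
have prodE A : measurable A ->
    (distribution P X \x distribution P Y)%E A = push mZ A.
  by apply: product_measure_unique => C D mC mD; exact: indep.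
have iuX : P.-integrable [set: T] (fun w => (u (X w))%:E).
  by apply: (@bounded_expectation_integrable _ B) => //; exact: measurableT_comp.
have ivY : P.-integrable [set: T] (fun w => (v (Y w))%:E).
  by apply: (@bounded_expectation_integrable _ B) => //; exact: measurableT_comp.
have iF : P.-integrable [set: T] (F \o Z).
  apply: (@bounded_expectation_integrable (fun w => u (X w) * v (Y w)) (B * B)).
    by apply: measurable_funM; exact: measurableT_comp.
  by move=> w; exact: (FB (Z w)).
have ipF : (push mZ).-integrable [set: R * R] F.
  by apply: integrable_pushforward => //; rewrite preimage_setT.
transitivity (\int[push mZ]_z F z)%E.
  by rewrite integral_pushforward// preimage_setT.
have idF : (distribution P X \x distribution P Y)%E.-integrable [set: R * R] F.
  apply/integrableP; split => //.
  rewrite (eq_measure_integral (push mZ)); last by move=> A mA _; exact: prodE.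
  by have /integrableP[] := ipF.
transitivity (\int[distribution P X \x distribution P Y]_z F z)%E.
  by apply/esym/eq_measure_integral => A mA _; exact: prodE.
have mEF (h : R -> R) : measurable_fun [set: R] h ->
    measurable_fun [set: R] (fun x => (h x)%:E) by move=> ?; exact/measurable_EFinP.
have Eu : (\int[distribution P X]_x (u x)%:E = \int[P]_w (u (X w))%:E)%E.
  exact: integral_distribution (mEF _ mu) iuX.
have Ev : (\int[distribution P Y]_x (v x)%:E = \int[P]_w (v (Y w))%:E)%E.
  exact: integral_distribution (mEF _ mv) ivY.
have iu : (distribution P X).-integrable [set: R] (fun x => (u x)%:E).
  by apply: integrable_pushforward => //; exact: mEF.
have iv : (distribution P Y).-integrable [set: R] (fun x => (v x)%:E).
  by apply: integrable_pushforward => //; exact: mEF.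
rewrite -integral12_prod_meas1// /fubini_F /F/=.
under eq_integral => x _.
  rewrite (eq_integral (fun y => (u x)%:E * (v y)%:E)%E) ?integralZl ?Ev//.
  over.
rewrite -Eu; have fv := integrable_fin_num measurableT ivY.
by rewrite -(fineK fv) integralZr.
Qed.

(** In the expanded square the off-diagonal terms have mean 0, and each of the [n] diagonal terms
    contributes at most [B ^ 2 / n ^ 2]. *)
Lemma variance_mean (n : nat) (X : 'I_n -> {RV P >-> R}) (u : R -> R) (B c : R) :
  (0 < n)%N -> mutually_independent X ->
  measurable_fun [set: R] u -> (forall x, `|u x| <= B) ->
  (forall i, \int[P]_w (u (X i w))%:E = c%:E)%E ->
  (\int[P]_w ((n%:R^-1 * \sum_(i < n) u (X i w) - c) ^+ 2)%:E
   <= (B ^+ 2 / n%:R)%:E)%E.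
Proof.
move=> n0 indep mu uB Eu; pose v x := u x - c.
have nn : n%:R != 0 :> R by rewrite pnatr_eq0 -lt0n.
have mX i : measurable_fun [set: T] (X i) by exact: measurable_funPT.
have mv : measurable_fun [set: R] v by exact: measurable_funB.
have vB x : `|v x| <= B + `|c| by rewrite (le_trans (ler_normB _ _))// lerD2r.
have iu i : P.-integrable [set: T] (fun w => (u (X i w))%:E).
  by apply: (@bounded_expectation_integrable _ B) => //; exact: measurableT_comp.
have iu2 i : P.-integrable [set: T] (fun w => (u (X i w) ^+ 2)%:E).
  apply: (@bounded_expectation_integrable _ (B ^+ 2)).
    by apply: measurable_funX; exact: measurableT_comp.
  by move=> w; rewrite normrX lerXn2r ?nnegrE// (le_trans _ (uB (X i w))).
have icst r : P.-integrable [set: T] (fun=> r%:E).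
  by apply: (@bounded_expectation_integrable _ `|r|).
have Ecst r : (\int[P]_w r%:E = r%:E)%E.
  by rewrite integral_cst//= [X in (_ * X)%E]probability_setT mule1.
have Ev i : (\int[P]_w (v (X i w))%:E = 0)%E.
  under eq_integral do rewrite /v EFinB.
  by rewrite integralB// Eu Ecst subee.
have ivv i l : P.-integrable [set: T] (fun w => (v (X i w) * v (X l w))%:E).
  apply: (@bounded_expectation_integrable _ ((B + `|c|) ^+ 2)).
    by apply: measurable_funM; exact: measurableT_comp.
  by move=> w; rewrite normrM expr2 ler_pM.
have cov i l : i != l -> (\int[P]_w (v (X i w) * v (X l w))%:E = 0)%E.
  move=> il; rewrite (@expectation_indep_mul _ _ _ _ (B + `|c|))// ?Ev ?mul0e//.
  move=> A C mA mC.
  (* Mutual independence, used for the index set [{i, l}], gives the independence of the pair. *)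
  pose D k := if k == i then A else C.
  have := indep [set i; l]%SET D; rewrite (big_setU1 _)/= ?inE// big_set1 /D eqxx.
  rewrite eq_sym (negbTE il) => <-; last by move=> k; case: ifP.
  congr (P _); apply/seteqP; split => w /=.
    move=> [wA wC] k /=; rewrite !inE => /orP[/eqP ->|/eqP ->]; first by rewrite eqxx.
    by rewrite eq_sym (negbTE il).
  move=> h; split.
    by have := h i; rewrite /= !inE eqxx; apply.
  by have := h l; rewrite /= !inE eqxx orbT eq_sym (negbTE il); apply.
(* The variance is the second moment minus [c ^ 2]. *)
have var i : (\int[P]_w (v (X i w) * v (X i w))%:E <= (B ^+ 2)%:E)%E.
  rewrite (_ : \int[P]_w _ = \int[P]_w ((u (X i w) ^+ 2)%:E -
      ((2 * c)%:E * (u (X i w))%:E - (c ^+ 2)%:E)))%E; last first.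
    by apply: eq_integral => w _; rewrite -EFinM -!EFinB; congr EFin; rewrite /v; ring.
  rewrite integralB//; last by apply: integrableB => //; exact: integrableZl.
  rewrite integralB//; last exact: integrableZl.
  rewrite integralZl// Eu Ecst.
  have fu2 := integrable_fin_num measurableT (iu2 i).
  apply: (@le_trans _ _ (\int[P]_w (u (X i w) ^+ 2)%:E)%E).
    rewrite -(fineK fu2) -EFinM -!EFinB lee_fin.
    by have := sqr_ge0 c; lra.
  rewrite -[leRHS]Ecst.
  apply: le_integral => // w _; rewrite lee_fin -[leLHS]real_normK ?num_real//.
  by rewrite lerXn2r ?nnegrE// (le_trans _ (uB (X i w))).
rewrite (_ : \int[P]_w _ =
    \int[P]_w \sum_(i < n) \sum_(l < n) (n%:R ^- 2)%:E * (v (X i w) * v (X l w))%:E)%E.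
  rewrite integral_sum//; last first.
    by move=> i; apply: integrable_sum => // *; exact: integrableZl.
  apply: (@le_trans _ _ (\sum_(i < n) (n%:R ^- 2 * B ^+ 2)%:E)%E).
    apply: lee_sum => i _; rewrite integral_sum//; last first.
      by move=> l; exact: integrableZl.
    rewrite (bigD1 i)//= big1 ?adde0; last first.
      by move=> l li; rewrite integralZl// cov 1?eq_sym// mule0.
    by rewrite integralZl// EFinM lee_pmul2l// lte_fin invr_gt0 exprn_gt0// ltr0n.
  rewrite sumEFin lee_fin sumr_const card_ord -mulr_natl.
  by rewrite le_eqVlt; apply/orP; left; apply/eqP; field.
apply: eq_integral => w _.
transitivity ((\sum_(i < n) \sum_(l < n)
    n%:R ^- 2 * (v (X i w) * v (X l w)))%:E)%E; last first.
  rewrite -sumEFin; apply: eq_bigr => i _; rewrite -sumEFin.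
  by apply: eq_bigr => l _; rewrite EFinM.
congr EFin; under [RHS]eq_bigr do rewrite -mulr_sumr -mulr_sumr.
rewrite -mulr_sumr -mulr_suml -expr2 -exprVn -exprMn; congr (_ ^+ 2).
rewrite sumrB sumr_const card_ord mulrBr -[c *+ n]mulr_natl mulKf//.
Qed.

End Independence.

(** * Bias and variance of the Legendre estimator *)

Section MeanIntegratedSquaredError.
Variable R : realType.
Variables (a b : R) (pi1 : R -> R) (p : nat -> {poly R}).
Hypothesis a0 : 0 < a.
Hypothesis ab : a < b.
Hypothesis hpi1 : density pi1.
Hypothesis hsupp : compact_support_nonneg pi1.
Hypothesis hp : legendre a b p.

Definition coef_estimator (n : nat) (x : 'I_n -> R) (k : nat) : R :=
  n%:R^-1 * \sum_(i < n) stat pi1 k.+1 (fun j => (p k)`_j) (x i).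

Lemma estimatorE m n (x : 'I_n -> R) t :
  estimator pi1 p m x t = (legendre_sum p m (coef_estimator x)).[t].
Proof. by rewrite horner_sum; apply: eq_bigr => k _; rewrite hornerZ. Qed.

Lemma L2dot_legendre_monomials f k : L2 a b f ->
  \sum_(j < k.+1) (p k)`_j * L2dot a b f (fun t => t ^+ j) =
  L2dot a b f (fun t => (p k).[t]).
Proof.
have [sp _ _] := hp; move=> f2; rewrite [RHS]L2dotC.
have pE : p k = \sum_(j < k.+1) (p k)`_j *: 'X^j by rewrite -poly_def -sp coefK.
rewrite [in RHS]pE L2dot_poly_sum//; apply: eq_bigr => j _.
rewrite L2dot_polyZ//; congr (_ * _).
by rewrite L2dotC; apply: eq_Rintegral => t _; rewrite hornerXn.
Qed.

Definition legendre_coef (f : R -> R) (k : nat) : R :=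
  L2dot a b f (fun t => (p k).[t]).

(** The class provides an element of [V_m] this close to [f], and the Legendre partial sum is at
    least as close. *)
Lemma approx_class_bias alpha C f m : (1 <= m)%N -> approx_class a b alpha C f ->
  L2dot a b (fun t => (legendre_sum p m (legendre_coef f)).[t] - f t)
            (fun t => (legendre_sum p m (legendre_coef f)).[t] - f t)
  <= (C * m%:R `^ (- alpha)) ^+ 2.
Proof.
move=> m1 fC; have [f2 _ hq] := fC; have [q [sq _] qf] := hq m m1.
apply: le_trans (legendre_sum_best hp f2 sq (fun k _ => erefl)) _.
rewrite -lee_fin -L2norm_sqr; last by apply: L2B => //; exact: L2_poly.
by rewrite expe2 expr2 EFinM; apply: lee_pmul => //; exact: Lnorm_ge0.
Qed.

Lemma measurable_stat n c : measurable_fun [set: R] (stat pi1 n c).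
Proof.
apply: measurable_sum => j; apply: measurable_funM => //.
apply: measurable_funM => //; exact: exprn_measurable.
Qed.

(** [D] and [B] come before [alpha], [C] and [f]: the bound is uniform over the class, and one [A]
    can serve all classes. *)
Lemma mise_bound : exists D B : R, [/\ 0 <= D, 1 <= B &
  forall alpha C f m n e, (1 <= m)%N -> (0 < n)%N ->
    approx_class a b alpha C f -> H1 a b f -> is_mise a b pi1 p m n f e ->
    (e <= (D * B ^+ m / n%:R + (C * m%:R `^ (- alpha)) ^+ 2)%:E)%E].
Proof.
have [D [B [D0 B1 DB]]] := coef_norm_legendre a0 ab hp.
have [M M0 hM] := density_support hsupp.
set G := Num.max 1 (b * M / moment pi1 1).
have G1 : 1 <= G by rewrite le_max lexx.
have G0 : 0 <= G by exact: le_trans G1.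
have B0 : 0 <= B by exact: le_trans B1.
have bM0 : 0 <= b * M by rewrite mulr_ge0 ?ltW// (lt_trans a0).
(* The statistic for [p k] is bounded by [D * B ^ k * G ^ k.+1], which is squared. The factor 2 in
   the base pays for the [m] coefficients, as [m <= 2 ^ m]. *)
exists ((D * G) ^+ 2), (2 * (B * G) ^+ 2); split.
- exact: sqr_ge0.
- have : 1 <= (B * G) ^+ 2 by rewrite expr_ge1 ?mulr_ege1// mulr_ge0.
  by lra.
move=> alpha C f m n e m1 n0 fC fH [d [T [P [X [[indep Xh] ->]]]]].
have [f2 _ _] := fC; pose dd := legendre_coef f.
pose r2 := L2dot a b (fun t => (legendre_sum p m dd).[t] - f t)
                     (fun t => (legendre_sum p m dd).[t] - f t).
pose Y w k := coef_estimator (fun i => X i w) k.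
have mX i : measurable_fun [set: T] (X i) by exact: measurable_funPT.
have mY k : measurable_fun [set: T] (fun w => (Y w k - dd k) ^+ 2).
  apply: measurable_funX; apply: measurable_funB => //.
  apply: measurable_funM => //; apply: measurable_sum => i.
  apply: measurableT_comp => //; exact: measurable_stat.
have mYE k : measurable_fun [set: T] (fun w => ((Y w k - dd k) ^+ 2)%:E).
  exact/measurable_EFinP.
(* Pointwise in [w], the loss is the squared error of the coefficients plus the deterministic
   squared bias [r2]. *)
rewrite (_ : \int[P]_w _ =
    \int[P]_w (\sum_(k < m) ((Y w k - dd k) ^+ 2)%:E + r2%:E))%E; last first.
  apply: eq_integral => w _; rewrite sumEFin -EFinD.
  rewrite -(L2norm_legendre_sum_sqr hp (Y w) f2 (fun k _ => erefl)).
  congr (L2norm _ _ _ ^+ 2)%E; apply/funext => t.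
  by rewrite estimatorE.
rewrite ge0_integralD//; last 3 first.
- by move=> w _; apply: sume_ge0 => k _; rewrite lee_fin sqr_ge0.
- exact: emeasurable_sum.
- by move=> w _; rewrite lee_fin L2dot_ge0.
rewrite integral_cst//= [X in (_ + _ * X)%E]probability_setT mule1 EFinD.
apply: leeD; last by rewrite lee_fin; exact: approx_class_bias.
rewrite ge0_integral_sum//; last by move=> k w _; rewrite lee_fin sqr_ge0.
apply: (@le_trans _ _ (\sum_(k < m) (((D * G) * (B * G) ^+ k) ^+ 2 / n%:R)%:E)%E).
  apply: lee_sum => k _.
  pose u := clipped_stat pi1 (b * M) k.+1 (fun j => (p k)`_j).
  have uB x : `|u x| <= (D * G) * (B * G) ^+ k.
    apply: le_trans (clipped_stat_bound hpi1 hsupp _ _ _ bM0) _.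
    rewrite exprMn [leRHS](_ : _ = (D * B ^+ k) * G ^+ k.+1); last first.
      by rewrite exprS; ring.
    by rewrite ler_wpM2r ?exprn_ge0//; exact: DB.
  have mu' : measurable_fun [set: R] u by exact: measurable_clipped_stat.
  apply: le_trans (variance_mean (c := dd k) n0 indep mu' uB _); last first.
    move=> i; rewrite (expectation_clipped_stat a0 hpi1 hsupp fH (Xh i) _ _ hM).
    by rewrite L2dot_legendre_monomials.
  rewrite le_eqVlt; apply/orP; left; apply/eqP; apply: ae_eq_integral => //.
    apply/measurable_EFinP; apply: measurable_funX; apply: measurable_funB => //.
    apply: measurable_funM => //; apply: measurable_sum => i.
    exact: measurableT_comp.
  (* Finitely many exceptional null events, one per observation, are discarded at once. *)
  have ae_all : {ae P, forall w, forall i : 'I_n,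
      u (X i w) = stat pi1 k.+1 (fun j => (p k)`_j) (X i w)}.
    by apply: filter_forall => i; exact: (clipped_statE a0 hpi1 fH (Xh i) _ _ hM).
  apply: filterS ae_all => w uw _.
  by rewrite /Y /coef_estimator (eq_bigr _ (fun i _ => uw i)).
rewrite sumEFin lee_fin -mulr_suml ler_wpM2r ?invr_ge0//.
have BG1 : 1 <= (B * G) ^+ 2 by rewrite expr_ge1 ?mulr_ege1// mulr_ge0.
apply: (@le_trans _ _ (\sum_(k < m) (D * G) ^+ 2 * ((B * G) ^+ 2) ^+ m)).
  apply: ler_sum => k _; rewrite exprMn ler_wpM2l ?sqr_ge0// -!exprM.
  by rewrite ler_weXn2l ?mulr_ege1// mulnC leq_pmul2l// ltnW.
rewrite sumr_const card_ord -[leLHS]mulr_natl [leLHS]mulrCA ler_wpM2l ?sqr_ge0//.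
rewrite [leRHS]exprMn; apply: ler_wpM2r; first by rewrite exprn_ge0// sqr_ge0.
by rewrite -natrX ler_nat ltnW// ltn_expl.
Qed.

End MeanIntegratedSquaredError.

(** * Comparison of both error terms with the logarithmic rate *)

Section Rates.
Variable R : realType.

(** After taking logarithms this is [ln y <= y] at [y = s / (4 * alpha)], multiplied by
    [2 * alpha]. *)
Lemma expR_half_le_powR (alpha s : R) : 0 < alpha -> 0 < s ->
  expR (- (s / 2)) <= (4 * alpha) `^ (2 * alpha) * s `^ (- (2 * alpha)).
Proof.
move=> al0 s0; have al4 : 0 < 4 * alpha by rewrite mulr_gt0.
rewrite /powR !gt_eqF// -expRD ler_expR.
have sa0 : 0 < s / (4 * alpha) by rewrite divr_gt0.
have := ln_sublinear sa0; rewrite lnM ?posrE ?invr_gt0// lnV ?posrE// => h.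
have : 2 * alpha * (ln s - ln (4 * alpha)) <= 2 * alpha * (s / (4 * alpha)).
  by rewrite ler_pM2l ?mulr_gt0// ltW.
rewrite (_ : 2 * alpha * (s / (4 * alpha)) = s / 2); last by field; rewrite gt_eqF.
lra.
Qed.

Lemma truncn_ge_half (x : R) : 2 <= x -> x / 2 <= (Num.truncn x)%:R.
Proof.
move=> x2; have x0 : 0 <= x by apply: le_trans x2.
have /andP[_] := truncn_itv x0; rewrite -natr1; lra.
Qed.

Lemma bias_rate (alpha C x s A : R) : 0 < alpha -> 0 < A -> 0 < s -> A * s / 2 <= x ->
  (C * x `^ (- alpha)) ^+ 2 <=
  C ^+ 2 * (A / 2) `^ (- (2 * alpha)) * s `^ (- (2 * alpha)).
Proof.
move=> al0 A0 s0 xs; have As0 : 0 < A * s / 2 by rewrite divr_gt0// mulr_gt0.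
have x0 : 0 < x by exact: lt_le_trans xs.
rewrite exprMn -mulrA ler_wpM2l ?sqr_ge0//.
rewrite -powRM ?divr_ge0 ?(ltW A0)// ?(ltW s0)// -powR_mulrn ?powR_ge0// -powRrM.
rewrite mulNr [alpha * 2]mulrC mulrAC.
rewrite !powRN lef_pV2 ?posrE ?powR_gt0//.
by apply: ge0_ler_powR; rewrite ?nnegrE ?(ltW As0) ?(ltW x0) ?mulr_ge0 ?(ltW al0).
Qed.

(** The condition on [m] says [B ^ m <= expR (s / 2)], and [n = expR s], so the quotient is at most
    [expR (- (s / 2))]. *)
Lemma variance_rate (D B alpha s : R) (m n : nat) : 0 <= D -> 1 <= B ->
  (0 < n)%N -> s = ln n%:R -> 0 < s -> 0 < alpha -> 2 * m%:R * ln B <= s ->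
  D * B ^+ m / n%:R <= D * (4 * alpha) `^ (2 * alpha) * s `^ (- (2 * alpha)).
Proof.
move=> D0 B1 n0 sE s0 al0 mB; rewrite -!mulrA ler_wpM2l//.
apply: le_trans (expR_half_le_powR al0 s0).
have nE : n%:R = expR s :> R by rewrite sE lnK// posrE ltr0n.
have B0 : 0 < B by exact: lt_le_trans B1.
have -> : B ^+ m = expR (m%:R * ln B) by rewrite expRM_natl lnK// posrE.
by rewrite nE -expRN -expRD ler_expR; lra.
Qed.

End Rates.

Theorem corollary1 (R : realType) (a b : R) (ha : 0 < a) (hab : a < b)
    (pi1 : R -> R) (hpi1 : density pi1) (hsupp : compact_support_nonneg pi1)
    (p : nat -> {poly R}) (hp : legendre a b p) :
  exists2 A : R, 0 < A &
    forall alpha C : R, 0 < alpha -> 0 < C ->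
      exists K : R, \forall n \near \oo,
        (ereal_sup
           [set e | exists2 f, (approx_class a b alpha C `&` H1 a b) f &
              is_mise a b pi1 p (Num.truncn (A * ln n%:R)) n f e]
         <= (K * ln n%:R `^ (- (2 * alpha)))%:E)%E.
Proof.
have [D [B [D0 B1 bound]]] := mise_bound ha hab hpi1 hsupp hp.
have lnB : 0 <= ln B by exact: ln_ge0.
(* This gives [2 * m * ln B <= ln n] whenever [m <= A * ln n]; the summand 1 keeps the denominator
   positive when [B = 1]. *)
pose A := (2 * (1 + ln B))^-1.
have A0 : 0 < A by rewrite invr_gt0 mulr_gt0// ltr_pwDl.
exists A => // alpha C al0 C0.
exists (D * (4 * alpha) `^ (2 * alpha) + C ^+ 2 * (A / 2) `^ (- (2 * alpha))).
near=> n; apply: ub_ereal_sup => e [f [fC fH] hmise].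
(* From here on [A * ln n >= 2], so its integer part is at least 1 and at least half of it. *)
have nbig : expR (2 / A) <= n%:R by near: n; exact: nbhs_infty_ger.
have n0 : (0 < n)%N by rewrite -(ltr0n R); apply: lt_le_trans nbig; exact: expR_gt0.
have sA : 2 / A <= ln n%:R.
  by rewrite -[leLHS]expRK ler_ln ?posrE ?expR_gt0 ?ltr0n.
have s0 : 0 < ln n%:R :> R by apply: lt_le_trans sA; rewrite divr_gt0.
have As2 : 2 <= A * ln n%:R by rewrite mulrC -ler_pdivrMr.
have m1 : (1 <= Num.truncn (A * ln n%:R : R))%N by rewrite truncn_gt0; lra.
apply: le_trans (bound _ _ _ _ _ _ m1 n0 fC fH hmise) _.
rewrite lee_fin [leRHS]mulrDl lerD//.
  apply: variance_rate => //.
  have : (Num.truncn (A * ln n%:R : R))%:R <= A * ln n%:R :> R.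
    by rewrite truncn_le; lra.
  set m : R := _%:R => mA.
  apply: (@le_trans _ _ (2 * (A * ln n%:R) * (1 + ln B))).
    by rewrite ler_pM ?mulr_ge0// ?ler_pM2l// lerDr.
  by rewrite /A le_eqVlt; apply/orP; left; apply/eqP; field; rewrite gt_eqF// ltr_pwDl.
apply: bias_rate => //; exact: truncn_ge_half.
Unshelve. all: by end_near.
Qed.
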